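(* Let $m\in\mathbb{N}$ be fixed. For $a,b\in\mathbb{N}$ put $f(a,b)=\gcd(ab,a+b)/\gcd(a,b)$. Then for real $x>1$, $$\sum_{\substack{a,b\le x\\ f(a,b)=m}} 1 = C_m x^2 + O\left(x(\log x)^3\right),$$ where $$C_m=\frac{C}{m^3}\prod_{p\mid m}\left(1-\frac{p^2}{p^3+p^2-1}\right),\qquad C=\prod_p\left(1-\frac{1}{p^2(p+1)}\right).$$
   Context: $\mathbb{N}=\{1,2,\ldots\}$; sums over $a,b\le x$ run over ordered pairs $(a,b)\in\mathbb{N}^2$ with $a\le x$ and $b\le x$ (satisfying the indicated condition). The function $f$ takes positive integer values. $\prod_p$ is a product over all primes and $\prod_{p\mid m}$ a product over the primes dividing $m$ (empty product equal to $1$).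
   Formalization: The O-bound is stated for x ≥ x0 with any fixed x0 > 1 and a constant depending on m and x0, since a single constant for all x > 1 is impossible: as x → 1+, x(log x)^3 → 0 while for m = 1 the error tends to 1 − C > 0. *)

(* Defs.v *)
From HB Require Import structures.
From mathcomp Require Import all_boot all_order all_algebra.
From mathcomp Require Import all_classical all_reals all_analysis.
Set Implicit Arguments.
Unset Strict Implicit.
Unset Printing Implicit Defensive.
Import Order.TTheory GRing.Theory Num.Theory.
Import numFieldNormedType.Exports.
Local Open Scope classical_set_scope.
Local Open Scope ring_scope.

(* The truncating division is exact on positive arguments, see gcd_dvd_gcd. *)
Definition gcd_ratio (a b : nat) : nat := (gcdn (a * b) (a + b) %/ gcdn a b)%N.

Lemma gcd_dvd_gcd (a b : nat) : (gcdn a b %| gcdn (a * b) (a + b))%N.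
Proof.
by rewrite dvdn_gcd dvdn_mulr ?dvdn_gcdl// dvdn_add ?dvdn_gcdl ?dvdn_gcdr.
Qed.

(* For real x >= 0, a natural number a satisfies a <= x iff a <= truncn x. *)
Definition pair_count (R : realType) (m : nat) (x : R) : nat :=
  (\sum_(1 <= a < (Num.truncn x).+1)
    \sum_(1 <= b < (Num.truncn x).+1 | gcd_ratio a b == m) 1)%N.

Definition C_partial (R : realType) (n : nat) : R :=
  \prod_(0 <= p < n | prime p) (1 - 1 / (p%:R ^+ 2 * (p%:R + 1))).

(* The infinite product over all primes: the limit exists by C_partial_cvg. *)
Definition C_const (R : realType) : R := limn (@C_partial R).

Lemma C_partial_cvg (R : realType) : cvgn (@C_partial R).
Proof.
have f01 (p : nat) : prime p ->
    0 <= 1 - 1 / (p%:R ^+ 2 * (p%:R + 1)) :> R.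
  move=> pp; have p1 : 1 <= p%:R :> R by rewrite ler1n prime_gt0.
  have d1 : 1 <= p%:R ^+ 2 * (p%:R + 1) :> R.
    by apply: mulr_ege1; [exact: exprn_ege1 | rewrite natr1 ler1n].
  by rewrite subr_ge0 ler_pdivrMr ?mul1r// (lt_le_trans ltr01 d1).
have pos n : 0 <= @C_partial R n by apply: prodr_ge0 => p; exact: f01.
apply: nonincreasing_is_cvgn; last first.
  by exists 0 => _ [n _ <-]; exact: pos.
apply/nonincreasing_seqP => n.
have -> : @C_partial R n.+1 = @C_partial R n *
    (if prime n then 1 - 1 / (n%:R ^+ 2 * (n%:R + 1)) else 1).
  by rewrite /C_partial big_mkcond big_nat_recr//= -big_mkcond.
case: ifP => pn; last by rewrite mulr1.
apply: ler_piMr; first exact: pos.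
by rewrite lerBlDr lerDl divr_ge0// mulr_ge0 ?exprn_ge0 ?addr_ge0.
Qed.

Definition C_coef (R : realType) (m : nat) : R :=
  C_const R / m%:R ^+ 3 *
  \prod_(p <- primes m) (1 - p%:R ^+ 2 / (p%:R ^+ 3 + p%:R ^+ 2 - 1)).

(* Main.v *)
(* Write P(n, Y) for the number of pairs a, b <= Y with n * gcd(a, b) | a + b.
   Since n | f(a, b) iff n | gcd(a, b) and n * gcd(a, b) | a + b, the pairs up
   to N with n | f(a, b) number P(n, N / n), and Moebius inversion over the
   multiples m * k of m gives the count of f(a, b) = m.

   If j is the part of a supported on the primes of n, the condition
   n * gcd(a, b) | a + b says that j | b and n | a / j + b / j.  For fixed a it
   is a congruence on b / j, so P(n, Y) = (Y / n) * sum_(a <= Y) 1 / j + O(Y).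
   Removing the primes of n one at a time, the inner sum is
   Y * prod_(p | n) p / (p + 1) up to prod_(p | n) 2p / (p - 1) <= 2n.  Hence
   P(n, Y) = Y^2 / (n * prod_(p | n) (1 + 1 / p)) + O(Y) uniformly in n, and
   summing over k <= N the total error is O(N log N).  The Moebius sum of the
   main terms is multiplicative and factors as the Euler product. *)
Require Import Defs.
From mathcomp Require Import all_boot all_order all_algebra.
From mathcomp Require Import all_classical all_reals all_analysis.
From mathcomp Require Import ring lra zify.
Import Order.TTheory GRing.Theory Num.Theory.
Local Open Scope ring_scope.

Set Implicit Arguments.
Unset Strict Implicit.

(** * Divisors of the ratio, and counting in residue classes *)

(** Put d = gcd(a, b), a = u d, b = v d. If n | u + v, coprimality of u and v makes n coprime to u
    v, so n d | u v d^2 reduces to n | d. *)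
Lemma dvdn_gcd_ratio (n a b : nat) : (0 < a)%N -> (0 < b)%N ->
  (n %| gcd_ratio a b)%N =
  (n %| gcdn a b)%N && (n * gcdn a b %| a + b)%N.
Proof.
move=> a0 b0; have d0 : (0 < gcdn a b)%N by rewrite gcdn_gt0 a0.
rewrite /gcd_ratio dvdn_divRL ?gcd_dvd_gcd// dvdn_gcd.
case ndab : (n * gcdn a b %| a + b)%N; rewrite ?andbF ?andbT//.
set d := gcdn a b in d0 ndab *.
have /dvdnP[u ua] : (d %| a)%N := dvdn_gcdl a b.
have /dvdnP[v vb] : (d %| b)%N := dvdn_gcdr a b.
have cuv : coprime u v.
  by rewrite /coprime -(eqn_pmul2r d0) mul1n muln_gcdl -ua -vb.
have nuv : (n %| u + v)%N by rewrite -(dvdn_pmul2r d0) mulnDl -ua -vb.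
have cnu : coprime n u.
  apply: (coprime_dvdl nuv).
  by rewrite coprime_sym /coprime gcdnDl -/(coprime _ _).
have cnv : coprime n v.
  apply: (coprime_dvdl nuv).
  by rewrite coprime_sym /coprime gcdnDr gcdnC -/(coprime _ _).
rewrite ua vb (_ : u * d * (v * d) = u * v * d * d)%N; last by ring.
by rewrite dvdn_pmul2r// Gauss_dvdr// coprimeMr cnu.
Qed.

Lemma big_nat_dvd (V : nmodType) (n N : nat) (F : nat -> V) : (0 < n)%N ->
  \sum_(1 <= a < N.+1 | (n %| a)%N) F a =
  \sum_(1 <= a < (N %/ n).+1) F (n * a)%N.
Proof.
move=> n0; rewrite -big_filter -(big_map (muln n) predT F).
apply: perm_big; apply: uniq_perm.
- by rewrite filter_uniq// iota_uniq.
- rewrite map_inj_uniq ?iota_uniq// => i j /eqP.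
  by rewrite eqn_pmul2l// => /eqP.
move=> i; rewrite mem_filter mem_index_iota ltnS; apply/andP/mapP => /=.
  move=> [/dvdnP[k ->] kN]; exists k; last by rewrite mulnC.
  by rewrite mem_index_iota ltnS leq_divRL//; nia.
move=> [k]; rewrite mem_index_iota ltnS leq_divRL// => kN ->.
by rewrite dvdn_mulr//; split => //; nia.
Qed.

Lemma divn_natr_itv (R : realFieldType) (n N : nat) : (0 < n)%N ->
  (N%:R / n%:R - 1 <= (N %/ n)%:R :> R) && ((N %/ n)%:R <= N%:R / n%:R :> R).
Proof.
move=> n0; have n0' : 0 < n%:R :> R by rewrite ltr0n.
rewrite ler_pdivlMr// lerBlDr ler_pdivrMr//.
rewrite natr1 -!natrM !ler_nat leq_trunc_div andbT.
by rewrite mulSn {1}(divn_eq N n) addnC leq_add2r ltnW// ltn_mod.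
Qed.

(** The count is the difference of the floors of (Z + u) / n and u / n, whose rounding errors both
    lie in [0, 1]. *)
Lemma count_dvd_shift (R : realFieldType) (n u Z : nat) : (0 < n)%N ->
  `|\sum_(1 <= v < Z.+1) (n %| u + v)%N%:R - Z%:R / n%:R| <= 1 :> R.
Proof.
move=> n0.
have -> : \sum_(1 <= v < Z.+1) (n %| u + v)%N%:R =
          ((Z + u) %/ n)%:R - (u %/ n)%:R :> R.
  rewrite !divn_count_dvd !natr_sum -addSn.
  rewrite (@big_cat_nat _ _ _ u.+1 _ (Z.+1 + u))/=; [|lia|lia].
  rewrite [X in _ = X - _]addrC addrK -{1}[u.+1]add1n big_addn addnK.
  by apply: eq_bigr => i _; rewrite addnC.
have /andP[] := @divn_natr_itv R _ (Z + u) n0.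
have /andP[] := @divn_natr_itv R _ u n0.
by rewrite natrD mulrDl ler_norml => *; apply/andP; split; lra.
Qed.

(** * Multiplicative sums over the divisors of a squarefree number *)

Lemma primes_coprimeM (a b : nat) : (0 < a)%N -> (0 < b)%N -> coprime a b ->
  perm_eq (primes (a * b)) (primes a ++ primes b).
Proof.
move=> a0 b0 cab; apply: uniq_perm; first exact: primes_uniq.
  rewrite cat_uniq !primes_uniq andbT/=.
  by move: cab; rewrite coprime_has_primes.
by move=> p; rewrite mem_cat primesM.
Qed.

Lemma divisors_primeM (p D : nat) : prime p -> (0 < D)%N -> ~~ (p %| D)%N ->
  perm_eq (divisors (p * D)) (divisors D ++ [seq p * d | d <- divisors D])%N.
Proof.
move=> pp D0 pD; have p0 := prime_gt0 pp.
have pdiv d : d \in divisors D -> ~~ (p %| d)%N.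
  rewrite -dvdn_divisors// => dD; apply: contra pD => pd.
  exact: dvdn_trans dD.
apply: uniq_perm; first exact: divisors_uniq.
  rewrite cat_uniq divisors_uniq map_inj_uniq ?divisors_uniq; last first.
    by move=> i j /eqP; rewrite eqn_pmul2l// => /eqP.
  rewrite andbT/=; apply/hasPn => _ /mapP[d _ ->].
  by apply/negP => /pdiv; rewrite dvdn_mulr.
move=> d; rewrite mem_cat -!dvdn_divisors ?muln_gt0 ?p0//.
apply/idP/orP.
  case pd : (p %| d)%N; move: pd; last first.
    by move=> pd; rewrite Gauss_dvdr; [left | rewrite coprime_sym prime_coprime// pd].
  move=> /dvdnP[e ->]; rewrite mulnC dvdn_pmul2l// => eD; right.
  by apply/mapP; exists e => //; rewrite -dvdn_divisors.
case=> [dD|/mapP[e]]; first exact: dvdn_mull.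
by rewrite -dvdn_divisors// => eD ->; rewrite dvdn_pmul2l.
Qed.

Lemma dvdn_prod_primes (s : seq nat) (p : nat) : all prime s -> prime p ->
  (p %| \prod_(q <- s) q)%N = (p \in s).
Proof.
move=> + pp; elim: s => [_|q s IH /= /andP[qp sp]].
  by rewrite big_nil dvdn1 in_nil; case: eqP pp => // ->.
by rewrite big_cons Euclid_dvdM// IH// in_cons dvdn_prime2.
Qed.

(** For p not dividing D, the divisors of p D are the divisors d of D and the products p d, so each
    prime contributes a factor 1 + [W p]. *)
Lemma sum_divisors_prod_primes (R : comPzRingType) (W : nat -> R) (s : seq nat) :
  uniq s -> all prime s -> W 1%N = 1 ->
  (forall p k, prime p -> (0 < k)%N -> ~~ (p %| k)%N ->
    W (p * k)%N = W p * W k) ->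
  \sum_(k <- divisors (\prod_(p <- s) p)%N) W k = \prod_(p <- s) (1 + W p).
Proof.
move=> + + W1 WM; elim: s => [_ _|p s IH /= /andP[ps us] /andP[pp sp]].
  by rewrite !big_nil big_cons big_nil W1 addr0.
have D0 : (0 < \prod_(q <- s) q)%N.
  by rewrite big_seq prodn_cond_gt0// => q /(allP sp)/prime_gt0.
have pD : ~~ (p %| \prod_(q <- s) q)%N by rewrite dvdn_prod_primes.
rewrite !big_cons (perm_big _ (divisors_primeM pp D0 pD))/= big_cat big_map/=.
rewrite -IH// mulrDl mul1r mulr_sumr; congr (_ + _).
rewrite big_seq [RHS]big_seq; apply: eq_bigr => k.
rewrite -dvdn_divisors// => kD; apply: WM => //; first exact: dvdn_gt0 kD.
by apply: contra pD => pk; exact: dvdn_trans kD.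
Qed.

(** * Moebius inversion *)

Section mobius.
Variable R : comPzRingType.

(* Agrees with the Moebius function only on squarefree arguments. *)
Definition mob (k : nat) : R := (-1) ^+ size (primes k).

Lemma mob1 : mob 1 = 1. Proof. by []. Qed.

Lemma mob_prime p : prime p -> mob p = -1.
Proof. by move=> pp; rewrite /mob primes_prime. Qed.

Lemma mob_primeM p k : prime p -> (0 < k)%N -> ~~ (p %| k)%N ->
  mob (p * k) = mob p * mob k.
Proof.
move=> pp k0 pk; rewrite /mob -exprD -size_cat; congr (_ ^+ _).
by apply/perm_size/primes_coprimeM => //; rewrite (prime_gt0, prime_coprime).
Qed.

(** The sum is the product over s of 1 - [p | e], which has a zero factor at [pdiv e] as soon as e >
    1. *)
Lemma sum_mob_dvd (s : seq nat) (e : nat) : uniq s -> all prime s ->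
  (0 < e)%N -> {subset primes e <= s} ->
  \sum_(k <- divisors (\prod_(p <- s) p)%N) mob k * (k %| e)%N%:R =
  (e == 1)%N%:R.
Proof.
move=> us sp e0 es; rewrite sum_divisors_prod_primes//; first last.
- move=> p k pp k0 pk; rewrite mob_primeM// Gauss_dvd ?prime_coprime//.
  by rewrite -mulnb natrM; ring.
- by rewrite mob1 dvd1n mulr1.
have [->|e1] := eqVneq e 1%N.
  rewrite big_seq big1// => p /(allP sp) pp.
  by rewrite dvdn1 (gtn_eqF (prime_gt1 pp)) mulr0 addr0.
have pp : prime (pdiv e) by apply: pdiv_prime; lia.
have ps : pdiv e \in s by apply: es; rewrite mem_primes pp e0 pdiv_dvd.
by rewrite (big_rem _ ps)/= mob_prime// pdiv_dvd mulr1 subrr mul0r.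
Qed.

End mobius.

(** * The sum of 1 / j, and the count P(n, Y) *)

Section density.
Variable R : realFieldType.

(** The index is a list of primes rather than n, so that primes can be removed one at a time. *)
Definition inv_part_sum (s : seq nat) (Y : nat) : R :=
  \sum_(1 <= a < Y.+1) (a`_[pred q in s])%N%:R^-1.

(** Split by whether p | a. If not, the parts for s and p :: s agree, and these terms are the sum
    for s minus its terms at multiples of p. If a = p a', the part is p times that of a'. *)
Lemma inv_part_sum_cons (p : nat) (s : seq nat) (Y : nat) :
  prime p -> p \notin s ->
  inv_part_sum (p :: s) Y = inv_part_sum s Y - inv_part_sum s (Y %/ p) +
    p%:R^-1 * inv_part_sum (p :: s) (Y %/ p).
Proof.
move=> pp ps; have p0 := prime_gt0 pp.
have nps : ([pred q in s]^').-nat p by rewrite pnatE// !inE.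
have ss (a : nat) : (0 < a)%N ->
    (((p * a)`_[pred q in s]) = (a`_[pred q in s]))%N.
  by move=> a0; rewrite partnM// part_p'nat ?mul1n// pnatE.
have -> : inv_part_sum s Y = inv_part_sum s (Y %/ p) +
    \sum_(1 <= a < Y.+1 | ~~ (p %| a)%N) (a`_[pred q in s])%N%:R^-1.
  rewrite {1}/inv_part_sum (bigID (fun a => p %| a)%N)/= big_nat_dvd//.
  by congr (_ + _); apply: eq_big_nat => a /andP[a0 _]; rewrite ss.
rewrite [X in _ = X + _]addrAC subrr add0r {1}/inv_part_sum (bigID (fun a => p %| a)%N)/=.
rewrite addrC big_nat_dvd//; congr (_ + _); last first.
  rewrite mulr_sumr; apply: eq_big_nat => a /andP[a0 _].
  rewrite partnM// part_pnat_id ?natrM ?invfM//.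
  by rewrite pnatE// !inE eqxx.
rewrite big_nat_cond [RHS]big_nat_cond.
apply: eq_bigr => a /andP[/andP[a0 _] pa].
congr (_%:R^-1); apply: eq_in_partn => q.
rewrite mem_primes => /and3P[_ _ qa]; rewrite !inE.
by case: eqP => // qp; rewrite qp (negbTE pa) in qa.
Qed.

(** For s = [primes n] this is n / psi(n), with psi the Dedekind function. *)
Definition psi_ratio (s : seq nat) : R := \prod_(p <- s) (p%:R / (p%:R + 1)).

Lemma psi_ratio01 (s : seq nat) : 0 <= psi_ratio s <= 1.
Proof.
have r01 (p : nat) : 0 <= (p%:R / (p%:R + 1) : R) <= 1.
  by rewrite divr_ge0 ?addr_ge0//= ler_pdivrMr ?ltr_wpDl// mul1r lerDl.
by rewrite prodr_ge0 ?prodr_ile1.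
Qed.

(** By [inv_part_sum_cons] the error consists of two errors for s, 1 / p times the error for p :: s
    at Y %/ p, and a rounding term of at most 1. The -1 in the bound absorbs the rounding term. *)
Lemma inv_part_sum_bound (s : seq nat) (Y : nat) : uniq s -> all prime s ->
  `|inv_part_sum s Y - Y%:R * psi_ratio s| <=
  \prod_(p <- s) (2 * p%:R / (p%:R - 1)) - 1.
Proof.
elim: s Y => [|p s IH] Y.
  move=> _ _; rewrite /psi_ratio !big_nil subrr mulr1 /inv_part_sum.
  under eq_bigr => a _ do rewrite /partn big_pred0 ?invr1//.
  by rewrite big_const_nat iter_addr addr0 subn1 /= subrr normr0.
move=> /= /andP[ps us] /andP[pp sp]; rewrite /psi_ratio !big_cons -/(psi_ratio s).
have p2 : 2 <= p%:R :> R by rewrite ler_nat prime_gt1.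
have p0 := prime_gt0 pp.
set g := psi_ratio s in IH *; set E := \prod_(q <- s) _ in IH *.
have g01 : 0 <= g <= 1 by exact: psi_ratio01.
have E1 : 1 <= E.
  by rewrite -subr_ge0; exact: le_trans (normr_ge0 _) (IH 0%N us sp).
(* Strong induction on Y, as the recursion returns to the same list p :: s at Y %/ p. *)
have [n] := ubnP Y; elim: n Y => // n IHn Y; rewrite ltnS => Yn.
have [->|Y0] := posnP Y.
  rewrite /inv_part_sum big_geq// mul0r subrr normr0 subr_ge0.
  by apply: mulr_ege1 => //; rewrite ler_pdivlMr; lra.
have yY : (Y %/ p < n)%N by apply: leq_trans Yn; rewrite ltn_Pdiv ?prime_gt1.
have := IHn _ yY; have := IH Y us sp; have := IH (Y %/ p)%N us sp.
have /andP[] := @divn_natr_itv R _ Y p0.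
rewrite (@inv_part_sum_cons _ _ Y pp ps).
move: (inv_part_sum s Y) (inv_part_sum s (Y %/ p)) => GY Gy.
move: (inv_part_sum (p :: s) (Y %/ p)) (Y %/ p)%N%:R => G' y.
rewrite -/g -/E; move: Y%:R p%:R p2 => Z P P2 y1 y2.
set c := 2 * P / (P - 1); set g' := P / (P + 1) * g => hGy hGY hG'.
(* The main term satisfies the recursion with the exact quotient Y / p in place of its floor. *)
have gE : Z * g - Z * g' = P^-1 * (Z * g - P^-1 * Z * g').
  by rewrite /g'; field; apply/andP; split; lra.
(* The factor 2p / (p - 1) is the solution of c = 2 + c / p, as the recursion for the error
   demands. *)
have cE : c * E = 2 * E + P^-1 * (c * E).
  by rewrite /c; field; apply/andP; split; lra.
have P01 : 0 < P^-1 <= 1 by rewrite invr_gt0 invf_le1; lra.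
have g'g : 0 <= g' <= g.
  rewrite /g' mulr_ge0 ?divr_ge0//; [|lra..]; rewrite ler_piMl//; first lra.
  by rewrite ler_pdivrMr; lra.
rewrite (_ : GY - Gy + P^-1 * G' - Z * g' = (GY - Z * g) - (Gy - y * g) +
  P^-1 * (G' - y * g') + (Z / P - y) * (g - P^-1 * g')); last first.
  rewrite -[LHS]addr0 -(subrr (Z * g - Z * g')) {1}gE; ring.
rewrite ler_norml.
have : `|(P^-1) * (G' - y * g')| <= P^-1 * (c * E - 1).
  by rewrite normrM gtr0_norm ?ler_pM2l; lra.
have : 0 <= (Z / P - y) * (g - P^-1 * g') <= 1.
  have ? : 0 <= g - P^-1 * g' <= 1 by nra.
  by rewrite mulr_ge0 ?mulr_ile1; lra.
move: hGy hGY; rewrite !ler_norml.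
by move=> /andP[? ?] /andP[? ?] /andP[? ?] /andP[? ?]; apply/andP; split; lra.
Qed.

Lemma prod_primes_le (n : nat) : (0 < n)%N -> (\prod_(p <- primes n) p <= n)%N.
Proof.
move=> n0; rewrite {2}(prod_prime_decomp n0) prime_decompE big_map/=.
rewrite big_seq [leqRHS]big_seq; apply: leq_prod => p pn.
rewrite -{1}[p]expn1 leq_exp2l ?logn_gt0//.
by move: pn; rewrite mem_primes => /andP[/prime_gt1].
Qed.

(** For p >= 3 the factor is at most p, and p = 2 gives 4, so the product is at most twice the
    radical of n. *)
Lemma prod_primes_ratio_le (n : nat) : (0 < n)%N ->
  \prod_(p <- primes n) (2 * p%:R / (p%:R - 1)) <= 2 * n%:R :> R.
Proof.
move=> n0.
have : (\prod_(p <- primes n) p)%N%:R * 2 <= 2 * n%:R :> R.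
  by rewrite mulrC ler_pM2l// ler_nat prod_primes_le.
apply: le_trans.
(* The induction over lists must record whether 2 has already used the one extra factor 2. *)
suff : forall s, uniq s -> all prime s ->
    \prod_(p <- s) (2 * p%:R / (p%:R - 1)) <=
    (\prod_(p <- s) p)%N%:R * (if 2%N \in s then 2 else 1) :> R.
  move=> /(_ (primes n) (primes_uniq n) (all_prime_primes n))/le_trans; apply.
  by rewrite ler_wpM2l//; case: ifP => _; lra.
elim=> [|p s IH] /=; first by rewrite !big_nil mulr1.
move=> /andP[ps us] /andP[pp sp]; rewrite !big_cons natrM.
have p2 : 2 <= p%:R :> R by rewrite ler_nat prime_gt1.
have := IH us sp; move: (\prod_(q <- s) q)%N => A.
have : 0 <= \prod_(q <- s) (2 * q%:R / (q%:R - 1)) :> R.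
  rewrite big_seq prodr_ge0// => q /(allP sp) /prime_gt1 q1.
  by rewrite divr_ge0 ?mulr_ge0// subr_ge0 ler1n ltnW.
move: (\prod_(q <- s) _) => B B0 BA.
rewrite in_cons; have [E2|p3] := eqVneq 2%N p; rewrite ?orTb ?orFb.
  move: BA; rewrite -E2 (negbTE (_ : 2%N \notin s)) ?E2//.
  rewrite mulr1 -E2 (_ : 2 * 2 / (2 - 1) = 4 :> R); last by field.
  rewrite /=; move: (A%:R : R) => a Ba; nra.
rewrite -[leRHS]mulrA ler_pM ?divr_ge0 ?mulr_ge0 ?subr_ge0 ?ler1n ?prime_gt0//.
have p3' : 3 <= p%:R :> R by rewrite ler_nat ltn_neqAle p3 prime_gt1.
rewrite ler_pdivrMr; last by lra.
nra.
Qed.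

(** Forward: n is coprime to a / gcd(a, b), so all of j lies in gcd(a, b). Backward: a / j is
    coprime to n, so n and gcd(a / j, b / j) are coprime divisors of a / j + b / j. *)
Lemma dvdn_mul_gcd_addn (n a b : nat) : (0 < n)%N -> (0 < a)%N -> (0 < b)%N ->
  let j := (a`_\pi(n))%N in
  (n * gcdn a b %| a + b)%N = (j %| b)%N && (n %| a %/ j + b %/ j)%N.
Proof.
move=> n0 a0 b0 j; have j0 : (0 < j)%N by exact: part_gt0.
have ja : (j %| a)%N by exact: dvdn_part.
have xE : (a %/ j = a`_\pi(n)^')%N.
  by rewrite -{1}(@partnC \pi(n) a a0) mulKn.
have cx : coprime n (a %/ j).
  by rewrite coprime_pi' ?xE ?part_gt0// part_pnat.
apply/idP/andP.
  have d0 : (0 < gcdn a b)%N by rewrite gcdn_gt0 a0.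
  have jd : j = ((gcdn a b)`_\pi(n))%N -> (j %| gcdn a b)%N.
    by move=> ->; exact: dvdn_part.
  set d := gcdn a b in d0 jd *.
  have /dvdnP[u ua] : (d %| a)%N := dvdn_gcdl a b.
  have /dvdnP[v vb] : (d %| b)%N := dvdn_gcdr a b.
  have u0 : (0 < u)%N by move: a0; rewrite ua muln_gt0 => /andP[].
  move=> ndab.
  have cuv : coprime u v.
    by rewrite /coprime -(eqn_pmul2r d0) mul1n muln_gcdl -ua -vb.
  have nuv : (n %| u + v)%N by rewrite -(dvdn_pmul2r d0) mulnDl -ua -vb.
  have cnu : coprime n u.
    apply: (coprime_dvdl nuv).
    by rewrite coprime_sym /coprime gcdnDl -/(coprime _ _).
  have jd' : (j %| d)%N.
    by apply: jd; rewrite /j ua partnM// part_p'nat ?mul1n// -coprime_pi'.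
  have jb : (j %| b)%N by apply: dvdn_trans jd' _; exact: dvdn_gcdr.
  split=> //; rewrite -divnDl// dvdn_divRL; last exact: dvdn_add.
  by apply: dvdn_trans ndab; rewrite dvdn_pmul2l.
move=> [jb nxy].
rewrite -(divnK ja) -(divnK jb) -muln_gcdl -mulnDl mulnA dvdn_pmul2r//.
rewrite Gauss_dvd; first by rewrite nxy dvdn_add ?dvdn_gcdl ?dvdn_gcdr.
by apply: coprime_dvdr cx; exact: dvdn_gcdl.
Qed.

(** This is P(n, Y). *)
Definition gcd_multiple_count (n Y : nat) : R :=
  \sum_(1 <= a < Y.+1) \sum_(1 <= b < Y.+1) (n * gcdn a b %| a + b)%N%:R.

Lemma gcd_multiple_count_bound (n Y : nat) : (0 < n)%N ->
  `|gcd_multiple_count n Y - Y%:R ^+ 2 * psi_ratio (primes n) / n%:R| <= 4 * Y%:R.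
Proof.
move=> n0; have n1 : 1 <= n%:R :> R by rewrite ler1n.
have n0' : 0 < n%:R :> R by rewrite ltr0n.
have GE : inv_part_sum (primes n) Y = \sum_(1 <= a < Y.+1) (a`_\pi(n))%N%:R^-1.
  by apply: eq_bigr => a _; congr (_%:R^-1); exact: eq_partn.
(* The error 2 is 1 for rounding Y / j plus 1 for counting a residue class. *)
have inner (a : nat) : (1 <= a < Y.+1)%N ->
    `|\sum_(1 <= b < Y.+1) (n * gcdn a b %| a + b)%N%:R -
      Y%:R / n%:R * (a`_\pi(n))%N%:R^-1| <= 2 :> R.
  move=> /andP[a0 _]; set j := (a`_\pi(n))%N.
  have j0 : (0 < j)%N by exact: part_gt0.
  have -> : \sum_(1 <= b < Y.+1) (n * gcdn a b %| a + b)%N%:R =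
            \sum_(1 <= v < (Y %/ j).+1) (n %| a %/ j + v)%N%:R :> R.
    transitivity (\sum_(1 <= b < Y.+1 | (j %| b)%N) (n %| a %/ j + b %/ j)%N%:R : R).
      rewrite [RHS]big_mkcond/=; apply: eq_big_nat => b /andP[b0 _].
      by rewrite dvdn_mul_gcd_addn// -/j; case: (j %| b)%N.
    by rewrite big_nat_dvd//; apply: eq_bigr => v _; rewrite mulKn.
  have := @count_dvd_shift R n (a %/ j) (Y %/ j) n0.
  have /andP[] := @divn_natr_itv R _ Y j0.
  move: (\sum_(1 <= _ < _) _) (Y %/ j)%N%:R => S y y1 y2.
  rewrite (mulrAC Y%:R).
  have : 0 <= (Y%:R / j%:R - y) / n%:R <= 1.
    by rewrite divr_ge0 ?subr_ge0//= ler_pdivrMr//; lra.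
  rewrite mulrBl !ler_norml.
  by move=> /andP[? ?] /andP[? ?]; apply/andP; split; lra.
have -> : gcd_multiple_count n Y - Y%:R ^+ 2 * psi_ratio (primes n) / n%:R =
    \sum_(1 <= a < Y.+1) (\sum_(1 <= b < Y.+1) (n * gcdn a b %| a + b)%N%:R -
      Y%:R / n%:R * (a`_\pi(n))%N%:R^-1) +
    Y%:R / n%:R * (inv_part_sum (primes n) Y - Y%:R * psi_ratio (primes n)).
  by rewrite sumrB -mulr_sumr -GE /gcd_multiple_count; ring.
(* The first 2Y collects the inner errors over all a; 2n bounds the error in the sum of 1 / j, which
   is weighted by Y / n. *)
rewrite (_ : 4 * Y%:R = 2 * Y%:R + Y%:R / n%:R * (2 * n%:R)); last first.
  by field; rewrite gt_eqF.
apply: (le_trans (ler_normD _ _)); apply: lerD.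
  apply: (le_trans (ler_norm_sum _ _ _)).
  rewrite big_nat; apply: le_trans (_ : \sum_(1 <= i < Y.+1) 2 <= _).
    by rewrite [leRHS]big_nat; apply: ler_sum => a; exact: inner.
  by rewrite sumr_const_nat subn1 -[leLHS]mulr_natr.
rewrite normrM ger0_norm ?divr_ge0// ler_wpM2l ?divr_ge0//.
apply: (le_trans (inv_part_sum_bound _ (primes_uniq n) (all_prime_primes n))).
by apply: le_trans (prod_primes_ratio_le n0); rewrite gerBl.
Qed.

End density.

(** * From P(n, Y) to the count of f(a, b) = m *)

Section main_term.
Variable R : realFieldType.

(** [pair_count m x] unfolds to this at [N = Num.truncn x]. *)
Definition gcd_ratio_count (m N : nat) : nat :=
  (\sum_(1 <= a < N.+1) \sum_(1 <= b < N.+1 | gcd_ratio a b == m) 1)%N.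

(** For a = n a' and b = n b' a factor n cancels from n gcd(a, b) | a + b, leaving the same
    condition on a' and b'. *)
Lemma sum_dvd_gcd_ratio (n N : nat) : (0 < n)%N ->
  \sum_(1 <= a < N.+1) \sum_(1 <= b < N.+1) (n %| gcd_ratio a b)%N%:R =
  gcd_multiple_count R n (N %/ n).
Proof.
move=> n0.
transitivity (\sum_(1 <= a < N.+1 | (n %| a)%N)
    \sum_(1 <= b < N.+1 | (n %| b)%N) (n * gcdn a b %| a + b)%N%:R : R).
  rewrite [RHS]big_mkcond/=; apply: eq_big_nat => a /andP[a0 _].
  case na : (n %| a)%N.
    rewrite [RHS]big_mkcond/=; apply: eq_big_nat => b /andP[b0 _].
    by rewrite dvdn_gcd_ratio// dvdn_gcd na/=; case: (n %| b)%N.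
  rewrite big_nat big1// => b /andP[b0 _].
  by rewrite dvdn_gcd_ratio// dvdn_gcd na.
rewrite big_nat_dvd//; apply: eq_bigr => a _.
rewrite big_nat_dvd//; apply: eq_bigr => b _.
by rewrite -muln_gcdr -mulnDr dvdn_pmul2l.
Qed.

(** Its divisors are the squarefree numbers with all primes below B. Summing over them keeps the
    inversion finite and yields exact partial Euler products. *)
Definition primorial (B : nat) : nat :=
  (\prod_(p <- [seq p <- index_iota 0 B | prime p]) p)%N.

Lemma primes_below_uniq (B : nat) : uniq [seq p <- index_iota 0 B | prime p].
Proof. by rewrite filter_uniq// iota_uniq. Qed.

Lemma primorial_gt0 (B : nat) : (0 < primorial B)%N.
Proof.
rewrite /primorial big_seq prodn_cond_gt0// => p.
by rewrite mem_filter => /andP[/prime_gt0].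
Qed.

(** Inversion is applied to e = f(a, b) / m. As f(a, b) divides gcd(a, b), which is at most N < B,
    every prime of e is below B. *)
Lemma gcd_ratio_count_mob (m N B : nat) : (0 < m)%N -> (N < B)%N ->
  (gcd_ratio_count m N)%:R = \sum_(k <- divisors (primorial B))
    mob R k * gcd_multiple_count R (m * k) (N %/ (m * k)).
Proof.
move=> m0 NB.
transitivity (\sum_(1 <= a < N.+1) \sum_(1 <= b < N.+1)
    \sum_(k <- divisors (primorial B))
      mob R k * (m * k %| gcd_ratio a b)%N%:R); last first.
  under eq_bigr => a _ do rewrite exchange_big/=.
  rewrite exchange_big/= [LHS]big_seq [RHS]big_seq; apply: eq_bigr => k.
  rewrite -dvdn_divisors ?primorial_gt0// => /(dvdn_gt0 (primorial_gt0 B)) k0.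
  rewrite -sum_dvd_gcd_ratio ?muln_gt0 ?m0// mulr_sumr.
  by apply: eq_bigr => a _; rewrite mulr_sumr.
rewrite natr_sum; apply: eq_big_nat => a /andP[a0 aN].
rewrite natr_sum big_mkcond/=; apply: eq_big_nat => b /andP[b0 _].
have fgcd : (gcd_ratio a b %| gcdn a b)%N.
  by have := dvdn_gcd_ratio (gcd_ratio a b) a0 b0; rewrite dvdnn => /esym/andP[].
have fa : (gcd_ratio a b <= a)%N.
  by apply: dvdn_leq => //; apply: dvdn_trans fgcd _; exact: dvdn_gcdl.
have f0 : (0 < gcd_ratio a b)%N by apply: dvdn_gt0 fgcd; rewrite gcdn_gt0 a0.
move: (gcd_ratio a b) fa f0 {fgcd} => f fa f0.
have [mf|mf] := boolP (m %| f)%N; last first.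
  rewrite big1 => [|k _]; last first.
    case mkf : (m * k %| f)%N; last by rewrite mulr0.
    by rewrite (dvdn_trans (dvdn_mulr k (dvdnn m)) mkf) in mf.
  by case: eqP => // fm; rewrite fm dvdnn in mf.
move: mf fa f0 => /dvdnP[e ->] fa; rewrite muln_gt0 => /andP[e0 _].
under eq_bigr => k _ do rewrite mulnC dvdn_pmul2r//.
rewrite sum_mob_dvd ?primes_below_uniq ?filter_all//.
  by rewrite -{2}[m]mul1n eqn_pmul2r//; case: eqP.
move=> p; rewrite mem_primes => /and3P[pp _ /dvdn_leq-/(_ e0) pe].
by rewrite mem_filter pp mem_index_iota/=; nia.
Qed.

(** With y = N / n and Y its floor, the estimate of P(n, Y) costs at most 4y, and y^2 - Y^2 <= 2y
    gives the rest of 6y. *)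
Lemma gcd_multiple_count_scaled (n N : nat) : (0 < n)%N ->
  `|gcd_multiple_count R n (N %/ n) -
    N%:R ^+ 2 * (psi_ratio R (primes n) / n%:R ^+ 3)| <= 6 * N%:R / n%:R.
Proof.
move=> n0; have n1 : 1 <= n%:R :> R by rewrite ler1n.
have n0' : 0 < n%:R :> R by rewrite ltr0n.
have := gcd_multiple_count_bound R (N %/ n) n0.
have /andP[] := divn_natr_itv R N n0.
have /andP[] := psi_ratio01 R (primes n).
have : 0 <= (N %/ n)%:R :> R by [].
move: (gcd_multiple_count _ _ _) (psi_ratio _ _) (N %/ n)%:R => P r Y Y0 r0 r1.
have : 0 <= N%:R / n%:R :> R by rewrite divr_ge0.
have -> : N%:R ^+ 2 * (r / n%:R ^+ 3) = (N%:R / n%:R) ^+ 2 * (r / n%:R).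
  by field; rewrite gt_eqF.
rewrite -[6 * _ / _]mulrA -[X in `|P - X| <= _]mulrA.
have : 0 <= r / n%:R <= 1.
  by rewrite divr_ge0//= ler_pdivrMr// mul1r (le_trans r1).
move: (r / n%:R) (N%:R / n%:R) => q y /andP[q0 q1] y0 Yy1 Yy.
rewrite !ler_norml => /andP[P1 P2].
have : 0 <= (y ^+ 2 - Y ^+ 2) * q <= 2 * y.
  have H : 0 <= y ^+ 2 - Y ^+ 2 <= 2 * y by apply/andP; split; nra.
  move: (y ^+ 2 - Y ^+ 2) H => z /andP[z0 z1].
  by rewrite mulr_ge0//= (le_trans _ z1)// ler_piMr.
by move=> /andP[? ?]; apply/andP; split; lra.
Qed.

Lemma sum_divisors_le (D X : nat) (F : nat -> R) : (0 < D <= X)%N ->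
  (forall k, 0 <= F k) ->
  \sum_(k <- divisors D) F k <= \sum_(1 <= k < X.+1) F k.
Proof.
move=> /andP[D0 DX] F0.
have pD : perm_eq (divisors D) [seq k <- index_iota 1 X.+1 | k \in divisors D].
  apply: uniq_perm; rewrite ?filter_uniq ?iota_uniq ?divisors_uniq// => k.
  rewrite mem_filter mem_index_iota; case kD : (k \in divisors D) => //=.
  move: kD; rewrite -dvdn_divisors// => kD.
  by rewrite (dvdn_gt0 D0 kD) ltnS (leq_trans _ DX)// dvdn_leq.
rewrite (perm_big _ pD) big_filter big_mkcond/=.
by apply: ler_sum => k _; case: ifP.
Qed.

Lemma sum_inv_consecutive (a b : nat) : (0 < a <= b)%N ->
  \sum_(a <= k < b) (k%:R * k.+1%:R)^-1 = a%:R^-1 - b%:R^-1 :> R.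
Proof.
move=> /andP[a0 ab]; rewrite -opprB -(telescope_sumr (fun k => k%:R^-1 : R) ab) -sumrN.
apply: eq_big_nat => k /andP[ak _].
have k0 : 0 < k%:R :> R by rewrite ltr0n (leq_trans a0).
by rewrite -natr1; field; apply/andP; split; lra.
Qed.

Lemma gcd_ratio_count_bound (m N B : nat) : (0 < m)%N -> (N < B)%N ->
  `|(gcd_ratio_count m N)%:R -
    N%:R ^+ 2 * \sum_(k <- divisors (primorial B))
      mob R k * (psi_ratio R (primes (m * k)) / (m * k)%:R ^+ 3)| <=
  6 * N%:R * \sum_(1 <= k < N.+1) k%:R^-1 + N%:R.
Proof.
move=> m0 NB; rewrite (gcd_ratio_count_mob m0 NB) mulr_sumr -sumrB.
(* The first term bounds the error for k <= N. The second bounds the main term for k > N, and its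
   sum telescopes to at most N. *)
pose F k : R := 6 * N%:R * ((k <= N)%N%:R / k%:R) + N%:R / (k%:R * k.+1%:R).
apply: (@le_trans _ _ (\sum_(k <- divisors (primorial B)) F k)).
  apply: (le_trans (ler_norm_sum _ _ _)).
  rewrite big_seq [leRHS]big_seq; apply: ler_sum => k.
  rewrite -dvdn_divisors ?primorial_gt0// => /(dvdn_gt0 (primorial_gt0 B)) k0.
  rewrite mulrCA -mulrBr normrM normrX normrN1 expr1n mul1r.
  have k1 : 1 <= k%:R :> R by rewrite ler1n.
  have k0' : 0 < k%:R :> R by rewrite ltr0n.
  have m1 : 1 <= m%:R :> R by rewrite ler1n.
  have mk : k%:R <= (m * k)%:R :> R by rewrite ler_nat leq_pmull.
  rewrite /F; have [kN|Nk] := leqP k N.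
    apply: (le_trans (gcd_multiple_count_scaled N _)); first by rewrite muln_gt0 m0.
    rewrite -[leLHS]addr0 lerD ?divr_ge0 ?mulr_ge0//.
    by rewrite mul1r ler_wpM2l ?mulr_ge0// lef_pV2 ?posrE// (lt_le_trans k0').
  (* Here m k > N, so P(m k, 0) = 0 and only the main term remains. It is at most N^2 / k^3 <= N /
     (k (k + 1)), because N + 1 <= k. *)
  rewrite divn_small; last by nia.
  rewrite /gcd_multiple_count big_geq// sub0r normrN mul0r mulr0 add0r.
  have /andP[r0 r1] := psi_ratio01 R (primes (m * k)).
  rewrite ger0_norm; last by rewrite !mulr_ge0 ?invr_ge0 ?exprn_ge0.
  apply: (@le_trans _ _ (N%:R ^+ 2 * (1 / k%:R ^+ 3))).
    rewrite ler_wpM2l ?exprn_ge0// ler_pM ?invr_ge0 ?exprn_ge0//.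
    rewrite lef_pV2 ?posrE ?exprn_gt0// ?(lt_le_trans k0')//.
    by rewrite lerXn2r ?nnegrE.
  rewrite mul1r ler_pdivrMr ?exprn_gt0//.
  rewrite -natr1 (_ : _ * k%:R ^+ 3 = N%:R * (k%:R ^+ 2 / (k%:R + 1))); last first.
    by field; rewrite !gt_eqF//; lra.
  rewrite ler_wpM2l// ler_pdivlMr; last lra.
  have : N%:R + 1 <= k%:R :> R by rewrite natr1 ler_nat.
  have : 0 <= N%:R :> R by [].
  by move: N%:R => ? ? ?; nra.
have F0 k : 0 <= F k by rewrite addr_ge0// mulr_ge0 ?divr_ge0 ?mulr_ge0.
(* The upper limit covers every divisor of the primorial and is at least N, so the sum can be split
   at N. *)
apply: (le_trans (sum_divisors_le (X := N + primorial B) _ F0)).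
  by rewrite primorial_gt0 leq_addl.
rewrite big_split/= -!mulr_sumr lerD//.
  rewrite ler_wpM2l ?mulr_ge0//.
  rewrite (@big_cat_nat _ _ _ N.+1)/= ?ltnS ?leq_addr//.
  rewrite [X in _ + X]big_nat [X in _ + X]big1 ?addr0; last first.
    by move=> k /andP[Nk _]; rewrite leqNgt Nk mul0r.
  rewrite big_nat [leRHS]big_nat; apply: ler_sum => k /andP[_].
  by rewrite ltnS => ->; rewrite mul1r.
by rewrite sum_inv_consecutive// invr1 -[leRHS]mulr1 ler_wpM2l// gerBl invr_ge0.
Qed.

(** Since k may share primes with m, the factor of m is split off first. The rest, [v], is
    multiplicative, with v(p) = 1 / p^3 for p | m and v(p) = 1 / (p^2 (p + 1)) otherwise. *)
Lemma sum_mob_euler (m B : nat) : (0 < m < B)%N ->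
  \sum_(k <- divisors (primorial B))
    mob R k * (psi_ratio R (primes (m * k)) / (m * k)%:R ^+ 3) =
  \prod_(0 <= p < B | prime p) (1 - 1 / (p%:R ^+ 2 * (p%:R + 1))) *
  (m%:R ^- 3 *
   \prod_(p <- primes m) (1 - p%:R ^+ 2 / (p%:R ^+ 3 + p%:R ^+ 2 - 1))).
Proof.
move=> /andP[m0 mB]; have m0' : m%:R != 0 :> R by rewrite pnatr_eq0 -lt0n.
pose v k : R := psi_ratio R [seq p <- primes k | ~~ (p %| m)%N] / k%:R ^+ 3.
have psiM (k : nat) : (0 < k)%N ->
    psi_ratio R (primes (m * k)) / (m * k)%:R ^+ 3 =
    psi_ratio R (primes m) / m%:R ^+ 3 * v k.
  move=> k0; have k0' : k%:R != 0 :> R by rewrite pnatr_eq0 -lt0n.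
  have pmk : perm_eq (primes (m * k))
      (primes m ++ [seq p <- primes k | ~~ (p %| m)%N]).
    apply: uniq_perm; first exact: primes_uniq.
      rewrite cat_uniq primes_uniq filter_uniq ?primes_uniq// andbT/=.
      apply/hasPn => p; rewrite mem_filter => /andP[pm _].
      by apply: contra pm; rewrite mem_primes => /and3P[].
    move=> p; rewrite primesM// mem_cat mem_filter !mem_primes m0 k0.
    by case: (prime p) => //=; case: (p %| m)%N.
  rewrite /v /psi_ratio (perm_big _ pmk) big_cat/= natrM exprMn.
  by field; rewrite m0' k0'.
under eq_big_seq => k.
  rewrite -dvdn_divisors ?primorial_gt0// => /(dvdn_gt0 (primorial_gt0 B)) k0.
  rewrite psiM// mulrCA; over.
rewrite -mulr_sumr sum_divisors_prod_primes ?primes_below_uniq ?filter_all//; first last.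
- move=> p k pp k0 pk; rewrite mob_primeM// /v /psi_ratio.
  have pmk := primes_coprimeM (prime_gt0 pp) k0 (_ : coprime p k).
  rewrite prime_coprime// in pmk; have := perm_filter (fun p => ~~ (p %| m)%N) (pmk pk).
  move=> /(perm_big _) ->; rewrite filter_cat big_cat/= natrM exprMn invfM; ring.
- by rewrite mob1 /v /psi_ratio big_nil expr1n divr1 mulr1.
have pm : perm_eq (primes m)
    [seq p <- [seq p <- index_iota 0 B | prime p] | (p %| m)%N].
  apply: uniq_perm; rewrite ?primes_uniq ?filter_uniq ?iota_uniq// => p.
  rewrite !mem_filter mem_index_iota mem_primes m0/=.
  case: (prime p); rewrite ?andbF//=; case pm : (p %| m)%N => //=.
  by rewrite (leq_ltn_trans _ mB)// dvdn_leq.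
rewrite mulrAC [RHS]mulrCA [RHS]mulrC; congr (_ * _).
rewrite /psi_ratio !(perm_big _ pm) !big_filter !big_filter_cond !big_mkcondr.
rewrite -!big_split/=; apply: eq_bigr => p pp.
have p2 : 2 <= p%:R :> R by rewrite ler_nat prime_gt1.
have p1 : p%:R + 1 != 0 :> R by rewrite gt_eqF//; lra.
have p0 : p%:R != 0 :> R by rewrite gt_eqF//; lra.
(* For p | m, both sides equal (p^3 - 1) / (p^2 (p + 1)), where the left side includes the factor p
   / (p + 1) taken from m. *)
rewrite mob_prime// /v /psi_ratio primes_prime//=; case: ifP => pm' /=.
  rewrite big_nil; field; rewrite p0 p1 andbT/= gt_eqF//.
  by move: p%:R p2 => P P2; nra.
by rewrite big_seq1 !mul1r; field; rewrite ?p0 ?p1.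
Qed.

End main_term.

(** * Truncation of the Euler product, and the harmonic sum *)

(** The partial products lie in [0, 1] and step n lowers them by at most 1 / (n (n + 1)). So they
    are nonincreasing, while subtracting 1 / n makes them nondecreasing, which traps the limit. *)
Lemma C_partial_tail (R : realType) (B : nat) : (0 < B)%N ->
  `|C_partial R B - C_const R| <= B%:R^-1.
Proof.
move=> B0.
have f01 (p : nat) : prime p ->
    [&& 0 <= (p%:R ^+ 2 * (p%:R + 1) : R)^-1,
      (p%:R ^+ 2 * (p%:R + 1) : R)^-1 <= (p%:R * p.+1%:R)^-1 &
      (p%:R * p.+1%:R : R)^-1 <= 1].
  move=> pp; have p1 : 1 <= p%:R :> R by rewrite ler1n prime_gt0.
  rewrite -natr1 invr_ge0 mulr_ge0 ?addr_ge0//=.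
  rewrite invf_le1 ?lef_pV2 ?posrE ?mulr_gt0 ?exprn_gt0 //; by nra.
have CS n : C_partial R n.+1 = C_partial R n *
    (if prime n then 1 - 1 / (n%:R ^+ 2 * (n%:R + 1)) else 1).
  by rewrite /C_partial big_mkcond big_nat_recr//= -big_mkcond.
have C01 n : 0 <= C_partial R n <= 1.
  elim: n => [|n /andP[IH0 IH1]]; first by rewrite /C_partial big_geq// ler01 lexx.
  rewrite CS; case: ifP => [/f01|]; last by rewrite mulr1 IH0.
  move: (_^-1) (_^-1) => y z; by rewrite mul1r => /and3P[? ? ?]; apply/andP; split; nra.
have dec n : C_partial R n.+1 <= C_partial R n.
  rewrite CS; case: ifP => [/f01|]; last by rewrite mulr1.
  have := C01 n; move: (C_partial R n) (_^-1) (_^-1) => c y z.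
  by rewrite mul1r => ? /and3P[? ? ?]; nra.
have inc n : (0 < n)%N ->
    C_partial R n - n%:R^-1 <= C_partial R n.+1 - n.+1%:R^-1.
  move=> n0; have -> : n.+1%:R^-1 = n%:R^-1 - (n%:R * n.+1%:R)^-1 :> R.
    have := @sum_inv_consecutive R n n.+1; rewrite n0 leqnSn => /(_ isT).
    by rewrite big_nat1 => ->; ring.
  rewrite CS; case: ifP => [/f01|_]; last first.
    have : 0 <= (n%:R * n.+1%:R : R)^-1 by rewrite invr_ge0 mulr_ge0.
    by move: (n%:R^-1) (_^-1) => w y ?; lra.
  have := C01 n; move: (C_partial R n) (n%:R^-1) (_^-1) (_^-1) => c w y z.
  by rewrite mul1r => ? /and3P[? ? ?]; nra.
have inc' n : (B <= n)%N -> C_partial R B - B%:R^-1 <= C_partial R n.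
  move=> Bn; apply: (@le_trans _ _ (C_partial R n - n%:R^-1)).
    elim: n Bn => [|n IH]; first by rewrite leqn0 => /eqP ->.
    rewrite leq_eqVlt => /orP[/eqP -> //|]; rewrite ltnS => Bn.
    by apply: le_trans (IH Bn) _; apply: inc; exact: leq_trans Bn.
  by rewrite gerBl invr_ge0.
have le1 : C_const R <= C_partial R B.
  apply: nonincreasing_cvgn_ge; last exact: C_partial_cvg.
  exact/nonincreasing_seqP.
have ge1 : C_partial R B - B%:R^-1 <= C_const R.
  apply: limr_ge; first exact: C_partial_cvg.
  by exists B => // n /= Bn; exact: inc'.
by rewrite ler_norml; apply/andP; split; lra.
Qed.

(** From N + 1 to N + 2, ln grows by -ln(1 - y) >= y with y = 1 / (N + 2). *)
Lemma harmonic_le_ln (R : realType) (N : nat) : (0 < N)%N ->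
  \sum_(1 <= k < N.+1) k%:R^-1 <= 1 + ln N%:R :> R.
Proof.
elim: N => [//|[|N] IH] _; first by rewrite big_nat1 ln1 invr1 addr0.
rewrite big_nat_recr//=; have := IH isT.
set y : R := N.+2%:R^-1.
have y01 : 0 < y < 1 by rewrite invr_gt0 ltr0n invf_lt1 ?ltr0n// ltr1n.
have -> : N.+1%:R = N.+2%:R * (1 + - y) :> R.
  by rewrite mulrDr mulrN mulfV// mulr1 -[N.+2%:R]natr1 addrK.
rewrite lnM ?posrE ?ltr0n//; last lra.
have := @le_ln1Dx R (- y); lra.
Qed.

(** The error obtained is x (A + 6 ln x). It is compared with x (ln x)^3 through ln x >= ln x0 > 0;
    as ln vanishes at 1, K depends on x0. *)
Theorem corollary2 (R : realType) (m : nat) (hm : (0 < m)%N)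
    (x0 : R) (hx0 : 1 < x0) :
  exists K : R, forall x : R, x0 <= x ->
    `|(pair_count m x)%:R - C_coef R m * x ^+ 2| <= K * (x * ln x ^+ 3).
Proof.
pose c : R := m%:R ^- 3 *
  \prod_(p <- primes m) (1 - p%:R ^+ 2 / (p%:R ^+ 3 + p%:R ^+ 2 - 1)).
have CE : C_coef R m = C_const R * c by rewrite /C_coef /c mulrA.
(* The 7 is 6 from the 1 in the harmonic bound plus 1 from the last N of [gcd_ratio_count_bound].
   Truncating the Euler product costs |c|, and replacing N^2 by x^2 costs 2 |C_m|. *)
pose A : R := 7 + `|c| + 2 * `|C_coef R m|.
exists (A / ln x0 ^+ 3 + 6 / ln x0 ^+ 2) => x x0x.
have x1 : 1 < x := lt_le_trans hx0 x0x.
have L0 : 0 < ln x0 by rewrite ln_gt0.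
have LL : ln x0 <= ln x by rewrite ler_ln ?posrE; lra.
suff : `|(pair_count m x)%:R - C_coef R m * x ^+ 2| <= x * (A + 6 * ln x).
  move=> /le_trans; apply; rewrite mulrCA ler_wpM2l//; first lra.
  have A0 : 0 <= A by rewrite !addr_ge0 ?mulr_ge0.
  rewrite [leRHS]mulrDl lerD//.
    rewrite mulrAC -mulrA ler_peMr// ler_pdivlMr ?exprn_gt0// mul1r.
    by rewrite lerXn2r ?nnegrE; lra.
  rewrite (exprSr _ 2) mulrA ler_wpM2r//; first lra.
  rewrite mulrAC -mulrA ler_peMr// ler_pdivlMr ?exprn_gt0// mul1r.
  by rewrite lerXn2r ?nnegrE; lra.
set N := Num.truncn x.
have /andP[Nx xN] : N%:R <= x < N.+1%:R by apply: truncn_itv; lra.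
have N0 : (0 < N)%N by rewrite truncn_gt0 ltW.
(* B = N + m + 1 exceeds N for the inversion and m for the Euler product, and leaves a tail of at
   most 1 / N. *)
have NB : (N < N + m.+1)%N by rewrite -addSnnS leq_addr.
have := @gcd_ratio_count_bound R m N (N + m.+1) hm NB.
rewrite sum_mob_euler; last by rewrite hm addnS ltnS leq_addl.
rewrite -/c -/(C_partial R (N + m.+1)).
rewrite -[gcd_ratio_count m N]/(pair_count m x).
have N1 : 1 <= N%:R :> R by rewrite ler1n.
have H : \sum_(1 <= k < N.+1) k%:R^-1 <= 1 + ln x.
  apply: le_trans (@harmonic_le_ln R N N0) _; rewrite lerD2l ler_ln ?posrE; lra.
have T : `|N%:R ^+ 2 * (C_partial R (N + m.+1) * c) - N%:R ^+ 2 * C_coef R m| <=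
    x * `|c|.
  rewrite CE -mulrBr -mulrBl mulrA normrM ler_wpM2r// normrM ger0_norm ?exprn_ge0//.
  apply: le_trans Nx.
  apply: (@le_trans _ _ (N%:R ^+ 2 * N%:R^-1)); last first.
    by rewrite expr2 mulfK// gt_eqF; lra.
  rewrite ler_wpM2l ?exprn_ge0//.
  apply: (le_trans (@C_partial_tail R _ _)); first by rewrite addnS.
  by rewrite lef_pV2 ?posrE ?ltr0n ?ler_nat ?addnS// -addnS leq_addr.
(* Here x - N <= 1 and x + N <= 2x. *)
have D : `|N%:R ^+ 2 * C_coef R m - C_coef R m * x ^+ 2| <= x * (2 * `|C_coef R m|).
  rewrite (mulrC _ (C_coef R m)) -mulrBr normrM mulrA [x * 2 * _]mulrC.
  rewrite ler_wpM2l// distrC ger0_norm; last by rewrite subr_ge0 lerXn2r ?nnegrE; lra.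
  move: xN; rewrite -natr1; nra.
move: (pair_count m x)%:R => P.
have S0 : 6 * N%:R * (\sum_(1 <= k < N.+1) k%:R^-1) <= 6 * (x * (1 + ln x)).
  rewrite -mulrA ler_wpM2l// ler_pM// sumr_ge0//.
move=> HP.
rewrite /A (_ : P - _ = (P - N%:R ^+ 2 * (C_partial R (N + m.+1) * c)) +
  (N%:R ^+ 2 * (C_partial R (N + m.+1) * c) - N%:R ^+ 2 * C_coef R m) +
  (N%:R ^+ 2 * C_coef R m - C_coef R m * x ^+ 2)); last by ring.
apply: (le_trans (ler_normD _ _)); apply: (le_trans (lerD (ler_normD _ _) D)).
move: HP T S0 Nx.
lra.
Qed.
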